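(* Let $P$ be the transition matrix of a finite irreducible Markov chain with states $\{1,\dots,m\}$, stationary probability vector $\boldsymbol{\pi}^T=(\pi_1,\dots,\pi_m)$ and mean first passage times $\{m_{ij}\}$, and let $K=\sum_{j=1}^m\pi_jm_{ij}$ be Kemeny's constant. If $G$ is a g-inverse of $I-P$ with $G\in A\{1,5a\}$, i.e. $G=G(\boldsymbol{e},\boldsymbol{\beta},\gamma)$, then $$K=\operatorname{tr}(G)-\gamma.$$ In particular, $K=\operatorname{tr}(Z)=\operatorname{tr}(A^{\#})+1$, where $Z=[I-P+\boldsymbol{e}\boldsymbol{\pi}^T]^{-1}$ and $A^{\#}=[I-P+\boldsymbol{e}\boldsymbol{\pi}^T]^{-1}-\boldsymbol{e}\boldsymbol{\pi}^T$.
   Context: $\boldsymbol{e}$ is the all-ones column vector; $\boldsymbol{\pi}^T$ is the unique stationary probability vector ($\boldsymbol{\pi}^TP=\boldsymbol{\pi}^T$, $\boldsymbol{\pi}^T\boldsymbol{e}=1$). $m_{ij}=E[T_{ij}\mid X_0=i]$, where $T_{ij}=\min\{n\ge 1: X_n=j\}$ given $X_0=i$ (first return when $i=j$); these are finite and $m_{jj}=1/\pi_j$. The sum $K=\sum_{j}\pi_jm_{ij}$ does not depend on $i$ (known fact). A g-inverse of $I-P$ is a real $m\times m$ matrix $G$ with $(I-P)G(I-P)=I-P$. Parametric form (known fact): every g-inverse $G$ of $I-P$ can be uniquely written as $G=[I-P+\boldsymbol{\alpha}\boldsymbol{\beta}^T]^{-1}+\gamma\boldsymbol{e}\boldsymbol{\pi}^T$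 with $\boldsymbol{\alpha},\boldsymbol{\beta}\in\mathbb{R}^m$, $\gamma\in\mathbb{R}$, $\boldsymbol{\pi}^T\boldsymbol{\alpha}=1$, $\boldsymbol{\beta}^T\boldsymbol{e}=1$; this is written $G=G(\boldsymbol{\alpha},\boldsymbol{\beta},\gamma)$. By definition $G\in A\{1,5a\}$ iff $\boldsymbol{\alpha}=\boldsymbol{e}$. *)

(* Defs.v *)
From HB Require Import structures.
From mathcomp Require Import all_boot all_order all_algebra.
From mathcomp Require Import all_classical all_reals all_analysis.

Set Implicit Arguments.
Unset Strict Implicit.
Unset Printing Implicit Defensive.

Import Order.TTheory GRing.Theory Num.Theory.
Import numFieldNormedType.Exports.

Local Open Scope classical_set_scope.
Local Open Scope ring_scope.

(* The states {1, ..., m} are represented by 'I_m,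
   and pi is a column vector, so that the row vector of the literature
   is pi^T. *)

Section TransitionMatrices.
Variables (R : realType) (m : nat).
Implicit Types (P A G : 'M[R]_m) (pi alpha beta : 'cV[R]_m) (gamma : R).

Definition ones : 'cV[R]_m := const_mx 1.

Definition stochastic P :=
  (forall i j, 0 <= P i j) /\ (forall i, \sum_j P i j = 1).

Definition irreducible_chain P := forall i j, exists n : nat, 0 < (P ^+ n) i j.

Definition stationary P pi :=
  [/\ forall i, 0 <= pi i 0, pi^T *m ones = 1%:M & pi^T *m P = pi^T].

Definition ginverse A G := A *m G *m A = A.

(* G = G(alpha, beta, gamma). When P is an irreducible stochastic matrix with
   stationary vector pi, the first two conditions make the matrix to be
   inverted nonsingular, so invmx never takes its default value. *)
Definition ginv_param P pi G alpha beta gamma :=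
  [/\ pi^T *m alpha = 1%:M,
      beta^T *m ones = 1%:M &
      G = invmx (1%:M - P + alpha *m beta^T) + gamma *: (ones *m pi^T)].

Definition fundamental_mx P pi : 'M[R]_m := invmx (1%:M - P + ones *m pi^T).

Definition group_inverse_mx P pi : 'M[R]_m :=
  invmx (1%:M - P + ones *m pi^T) - ones *m pi^T.

End TransitionMatrices.

Arguments ones {R m}.

Section MarkovChains.
Variables (d : measure_display) (Omega : measurableType d) (R : realType).
Variables (Pr : probability Omega R) (m : nat).
Implicit Types (P : 'M[R]_m) (pi : 'cV[R]_m) (X : nat -> Omega -> 'I_m).

Definition history X (h : nat -> 'I_m) (n : nat) : set Omega :=
  [set w | forall k, (k <= n)%N -> X k w = h k].

(* The last clause is
     Pr(X_{n+1} = h_{n+1} | X_n = h_n, ..., X_0 = h_0) = P h_n h_{n+1},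
   multiplied out so that histories of probability 0 are unconstrained.
   The law of X_0 is arbitrary. *)
Definition markov_chain P X :=
  (forall n x, measurable (X n @^-1` [set x])) /\
  (forall h n,
     Pr (history X h n.+1) = (Pr (history X h n) * (P (h n) (h n.+1))%:E)%E).

(* min {n >= 1 : X_n = j}, equal to +oo if j is never visited. *)
Definition first_passage X (j : 'I_m) (w : Omega) : \bar R :=
  ereal_inf [set n%:R%:E | n in [set n : nat | (0 < n)%N /\ X n w = j]].

Definition cond_expectation (f : Omega -> \bar R) (B : set Omega) : \bar R :=
  ((\int[Pr]_(w in B) f w) / Pr B)%E.

(* E[T_ij | X_0 = i]; meaningful when Pr(X_0 = i) > 0. *)
Definition mean_first_passage X (i j : 'I_m) : \bar R :=
  cond_expectation (first_passage X j) (X 0%N @^-1` [set i]).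

Definition kemeny X pi (i : 'I_m) : \bar R :=
  (\sum_(j < m) (pi j 0)%:E * mean_first_passage X i j)%E.

End MarkovChains.

(* Main.v *)
(* Let T_j be the first passage time to j and s_n(a) = Pr_a(T_j > n). The partial
   sums S_N of s satisfy pi_j S_N(j) <= 1 by stationarity, and irreducibility
   propagates this bound from j to every state. The limits m_aj then solve
   m_aj = 1 + sum_{b <> j} P_ab m_bj, whence pi_j m_jj = 1. With N = (m_aj pi_j)
   this reads (I - P) N = e pi^T - P, together with tr N = m, so that
   W = I - P + e beta^T has the inverse I - N - e c^T for an explicit row c^T.
   A vector u with (I - P) u = 0 satisfies W u = (beta^T u) e = (beta^T u) W e and is
   therefore constant. This applies to N e, whose entries are Kemeny's constant
   beta^T N e, and tr (I - N - e c^T) = - c^T e = beta^T N e. *)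

Require Import Defs.
From HB Require Import structures.
From mathcomp Require Import all_boot all_order all_algebra.
From mathcomp Require Import all_classical all_reals all_analysis.
From mathcomp Require Import measurable_realfun.

Set Implicit Arguments.
Unset Strict Implicit.
Unset Printing Implicit Defensive.

Import Order.TTheory GRing.Theory Num.Theory.
Import numFieldNormedType.Exports.
Local Open Scope classical_set_scope.
Local Open Scope ring_scope.

Lemma cvg_finite_sum (R : realType) (I : Type) (r : seq I) (A : pred I)
    (u : I -> R ^nat) (l : I -> R) :
  (forall k, A k -> u k n @[n --> \oo] --> l k) ->
  \sum_(k <- r | A k) u k n @[n --> \oo] --> \sum_(k <- r | A k) l k.
Proof.
move=> ul; elim: r => [|k r IHr].
  by under eq_fun do rewrite big_nil; rewrite big_nil; exact: cvg_cst.
under eq_fun do rewrite big_cons; rewrite big_cons.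
by case: ifPn => // Ak; apply: cvgD => //; exact: ul.
Qed.

(** * Survival probabilities, the convergence of their series and its limits *)

Section Survival.
Variables (R : realType) (m : nat) (P : 'M[R]_m) (pi : 'cV[R]_m).
Hypothesis P_stochastic : stochastic P.
Hypothesis P_irreducible : irreducible_chain P.
Hypothesis pi_stationary : stationary P pi.

(* [survival j n a] is Pr(X_1, ..., X_n <> j | X_0 = a). *)
Fixpoint survival (j : 'I_m) (n : nat) (a : 'I_m) : R :=
  if n is n'.+1 then \sum_(b | b != j) P a b * survival j n' b else 1.

Let S j a : R ^nat := series (fun n => survival j n a).

Lemma survival_ge0 j n a : 0 <= survival j n a.
Proof.
case: P_stochastic => P_ge0 _; elim: n a => [|n IHn] a //=.
by apply: sumr_ge0 => b _; rewrite mulr_ge0.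
Qed.

Lemma survival_seriesS j a N :
  S j a N.+1 = 1 + \sum_(b | b != j) P a b * S j b N.
Proof.
rewrite /S /series /= big_nat_recl //=; congr (1 + _).
rewrite exchange_big /=; apply: eq_bigr => b _.
by rewrite mulr_sumr.
Qed.

Lemma survival_series_nondecreasing j a :
  {homo S j a : n p / (n <= p)%N >-> n <= p}.
Proof.
by apply: nondecreasing_series => n _ _; exact: survival_ge0.
Qed.

Lemma survival_series_ge0 j a N : 0 <= S j a N.
Proof. by apply: sumr_ge0 => n _; exact: survival_ge0. Qed.

Lemma stationary_sum : \sum_a pi a 0 = 1.
Proof.
case: pi_stationary => _ /matrixP/(_ 0 0) + _.
by rewrite !mxE eqxx mulr1n => <-; apply: eq_bigr => a _; rewrite !mxE mulr1.
Qed.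

Lemma stationary_step b : \sum_a pi a 0 * P a b = pi b 0.
Proof.
case: pi_stationary => _ _ /matrixP/(_ 0 b).
by rewrite !mxE => <-; apply: eq_bigr => a _; rewrite !mxE.
Qed.

Lemma stochastic_exp_ge0 n a b : 0 <= (P ^+ n) a b.
Proof.
case: P_stochastic => P_ge0 _; elim: n b => [|n IHn] b.
  by rewrite expr0 mxE ler0n.
by rewrite exprSr -mulmxE mxE sumr_ge0 // => c _; rewrite mulr_ge0.
Qed.

(** Some entry pi_a is positive because the entries sum to 1. Stationarity under P^n, for an n with
    (P^n)_aj > 0, carries this positivity over to j. *)
Lemma stationary_gt0 j : 0 < pi j 0.
Proof.
case: pi_stationary => pi_ge0 _ piP.
have piPn n : pi^T *m (P ^+ n) = pi^T.
  elim: n => [|n IHn]; first by rewrite expr0 mulmx1.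
  by rewrite exprSr -mulmxE mulmxA IHn piP.
have [a /= pia] : exists a, xpredT a && (0 < pi a 0).
  by apply: psumr_neq0P => //; rewrite stationary_sum; apply/eqP; rewrite oner_eq0.
have [n Pnaj] := P_irreducible a j.
have /matrixP/(_ 0 j) := piPn n.
rewrite !mxE => <-; rewrite (bigD1 a) //= mxE.
rewrite ltr_wpDr ?mulr_gt0 // sumr_ge0 // => b _.
by rewrite mxE mulr_ge0 // stochastic_exp_ge0.
Qed.

(** Averaging against pi absorbs one step of the chain. This is applied both to the partial sums, to
    bound them, and to their limits, to compute m_jj. *)
Lemma stationary_taboo j (f : 'I_m -> R) :
  \sum_a pi a 0 * (\sum_(b | b != j) P a b * f b) = \sum_(b | b != j) pi b 0 * f b.
Proof.
under eq_bigr => a _ do rewrite mulr_sumr.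
rewrite exchange_big /=; apply: eq_bigr => b _.
under eq_bigr => a _ do rewrite mulrA.
by rewrite -mulr_suml stationary_step.
Qed.

(** The pi-average of the recursion for S_{N+1} has the terms pi_b S_{N+1}(b), b <> j, on the left
    and pi_b S_N(b) on the right. The former dominate the latter by monotonicity, which leaves pi_j
    S_{N+1}(j) <= 1. Everything is finite here, so cancellation is legitimate before convergence is
    known. *)
Lemma survival_series_return j N : pi j 0 * S j j N <= 1.
Proof.
case: pi_stationary => pi_ge0 _ _.
apply: (@le_trans _ _ (pi j 0 * S j j N.+1)).
  by rewrite ler_wpM2l // survival_series_nondecreasing.
have : \sum_a pi a 0 * S j a N.+1 = 1 + \sum_(b | b != j) pi b 0 * S j b N.
  under eq_bigr => a _ do rewrite survival_seriesS mulrDr mulr1.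
  by rewrite big_split /= stationary_sum stationary_taboo.
rewrite (bigD1 j) //= => S_eq.
rewrite -(lerD2r (\sum_(b | b != j) pi b 0 * S j b N.+1)) S_eq.
rewrite lerD2l ler_sum // => b _.
by rewrite ler_wpM2l // survival_series_nondecreasing.
Qed.

(** Induction on the length of a path from j to b. If c precedes b <> j on it, the recursion gives
    P_cb S_N(b) <= S_{N+1}(c), so a bound at c divided by P_cb is a bound at b. A path that ends in
    j itself falls back on the return bound. *)
Lemma survival_series_bounded j b : exists C, forall N, S j b N <= C.
Proof.
case: P_stochastic => P_ge0 _.
have return_bounded : exists C, forall N, S j j N <= C.
  exists (pi j 0)^-1 => N.
  by rewrite -[leRHS]mul1r ler_pdivlMr ?stationary_gt0 // mulrC survival_series_return.
have [n] := P_irreducible j b.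
elim: n b => [|n IHn] b.
  by rewrite expr0 mxE; case: (eqVneq j b) => [<- //|_]; rewrite ltxx.
rewrite exprSr -mulmxE mxE => Pjb_gt0.
have [|c /= jcb] := psumr_neq0P _ (elimN eqP (lt0r_neq0 Pjb_gt0)).
  by move=> c _; rewrite mulr_ge0 // stochastic_exp_ge0.
have Pjc : 0 < (P ^+ n) j c.
  by rewrite lt_neqAle stochastic_exp_ge0 andbT eq_sym; apply: contraTneq jcb => ->; rewrite mul0r ltxx.
have Pcb : 0 < P c b.
  by rewrite lt_neqAle P_ge0 andbT eq_sym; apply: contraTneq jcb => ->; rewrite mulr0 ltxx.
have [C SC] := IHn c Pjc.
case: (eqVneq b j) => [-> //|bj].
exists (C / P c b) => N; rewrite ler_pdivlMr // mulrC.
apply: le_trans (SC N.+1); rewrite survival_seriesS (bigD1 b) //=.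
rewrite addrCA lerDl addr_ge0 // sumr_ge0 // => x _.
by rewrite mulr_ge0 // survival_series_ge0.
Qed.

Lemma survival_series_cvg j a : cvgn (S j a).
Proof.
apply: nondecreasing_is_cvgn; first exact: survival_series_nondecreasing.
have [C SC] := survival_series_bounded j a.
by exists C => _ [N _ <-].
Qed.

(** This is E(T_j) as the sum of Pr(T_j > n) over n, computed from P alone, with no reference to a
    probability space. *)
Definition mean_passage a j : R := limn (series (fun n => survival j n a)).

Lemma mean_passage_step a j :
  mean_passage a j = 1 + \sum_(b | b != j) P a b * mean_passage b j.
Proof.
apply: (@cvg_unique _ _ (S j a @ \oo)) => //.
  exact: survival_series_cvg.
rewrite /= -(cvg_shiftS (S j a)) /=; under eq_fun do rewrite survival_seriesS.
apply: cvgD; first exact: cvg_cst.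
apply: cvg_finite_sum => b _; apply: cvgMl_tmp; exact: survival_series_cvg.
Qed.

Lemma mean_passage_return j : pi j 0 * mean_passage j j = 1.
Proof.
have : \sum_a pi a 0 * mean_passage a j =
       1 + \sum_(b | b != j) pi b 0 * mean_passage b j.
  under eq_bigr => a _ do rewrite mean_passage_step mulrDr mulr1.
  by rewrite big_split /= stationary_sum stationary_taboo.
by rewrite (bigD1 j) //= => /addIr.
Qed.

(** * The weighted passage matrix and the inverse of [W] *)

Definition weighted_passage : 'M[R]_m := \matrix_(a, j) (mean_passage a j * pi j 0).

Lemma weighted_passage_trace : \tr weighted_passage = m%:R.
Proof.
rewrite /mxtrace; under eq_bigr => j _ do rewrite mxE mulrC mean_passage_return.
by rewrite sumr_const card_ord.
Qed.

Lemma weighted_passage_eq : (1%:M - P) *m weighted_passage = ones *m pi^T - P.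
Proof.
rewrite mulmxBl mul1mx; apply/matrixP => a j; rewrite !mxE big_ord1 !mxE mul1r.
under eq_bigr => b _ do rewrite mxE mulrA.
rewrite mean_passage_step mulrDl mul1r -addrA; congr (_ + _).
(* The first-step equation omits b = j, whereas the matrix product includes it. The extra term is
   P_aj m_jj pi_j = P_aj. *)
rewrite [in X in _ - X](bigD1 j) //= -mulrA [mean_passage j j * _]mulrC.
by rewrite mean_passage_return mulr1 opprD addrCA mulr_suml subrr addr0.
Qed.

Lemma stochastic_ones : P *m ones = ones.
Proof.
case: P_stochastic => _ P1; apply/matrixP => a k; rewrite !mxE -[RHS](P1 a).
by apply: eq_bigr => b _; rewrite mxE mulr1.
Qed.

Lemma passage_inverse_trace beta : beta^T *m ones = 1%:M ->
  let W := 1%:M - P + ones *m beta^T in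
  W \in unitmx /\ weighted_passage *m ones = \tr (invmx W) *: ones.
Proof.
move=> beta1 W.
case: pi_stationary => _ pi1 _.
pose N := weighted_passage.
(* The choice is forced: W (I - N) = I - e pi^T + e beta^T (I - N) = I + e c and W e = e, so
   subtracting e c from I - N gives a right inverse of W. *)
pose c := beta^T *m (1%:M - N) - pi^T.
have W1 : W *m ones = ones.
  by rewrite mulmxDl mulmxBl mul1mx stochastic_ones subrr add0r -mulmxA beta1 mulmx1.
have WV : W *m (1%:M - N - ones *m c) = 1%:M.
  have AH : (1%:M - P) *m (1%:M - N) = 1%:M - ones *m pi^T.
    by rewrite mulmxBr mulmx1 weighted_passage_eq opprB addrA subrK.
  rewrite mulmxBr [W *m (ones *m c)]mulmxA W1 {1}/W mulmxDl AH -[ones *m _ *m _]mulmxA.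
  by rewrite /c [ones *m (_ - _)]mulmxBr opprB -addrA [X in _ + X]addrC !subrK.
have [W_unit _] := mulmx1_unit WV; split=> //.
have WVE : invmx W = 1%:M - N - ones *m c.
  by rewrite -[RHS](mulKmx W_unit) WV mulmx1.
have VW1 : invmx W *m ones = ones by rewrite -{1}W1 mulKmx.
have N1 : N *m ones = ones *m (beta^T *m (N *m ones)).
  have AN1 : (1%:M - P) *m (N *m ones) = 0.
    by rewrite mulmxA weighted_passage_eq mulmxBl -mulmxA pi1 mulmx1 stochastic_ones subrr.
  have : W *m (N *m ones) = ones *m (beta^T *m (N *m ones)).
    by rewrite {1}/W mulmxDl AN1 add0r -mulmxA.
  move=> /(congr1 (mulmx (invmx W))).
  by rewrite mulKmx // [invmx W *m _]mulmxA VW1.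
have c1 : c *m ones = - (beta^T *m (N *m ones)).
  by rewrite /c mulmxBl -mulmxA mulmxBl mul1mx mulmxBr beta1 pi1 addrAC subrr sub0r.
clearbody c.
(* Both I and N have trace m, so only - tr (e c) = - c e survives. *)
rewrite N1 WVE !raddfB /= mxtrace1 weighted_passage_trace subrr add0r.
rewrite mxtrace_mulC c1 raddfN /= opprK trace_mx11.
by rewrite [X in ones *m X = _]mx11_scalar mul_mx_scalar.
Qed.

End Survival.

(** * Mean first passage times of the process as series of survival probabilities *)

Section Passage.
Variables (R : realType) (m : nat) (P : 'M[R]_m).
Variables (d : measure_display) (Omega : measurableType d) (Pr : probability Omega R).
Variable (X : nat -> Omega -> 'I_m).
Hypothesis P_stochastic : stochastic P.
Hypothesis X_markov : markov_chain Pr P X.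

(** The window is the k times following n. Its starting point is a parameter because the induction
    on k conditions on one more step and moves n forward. For n = 0 this is the event T_j > k. *)
Definition avoids (j : 'I_m) (n k : nat) : set Omega :=
  [set w | forall l, (n < l <= n + k)%N -> X l w != j].

Lemma avoids0 j n : avoids j n 0 = setT.
Proof.
apply/seteqP; split=> // w _ l.
by rewrite addn0 => /andP[/leq_trans/[apply]]; rewrite ltnn.
Qed.

Lemma avoidsS j n k w :
  avoids j n k.+1 w <-> X n.+1 w != j /\ avoids j n.+1 k w.
Proof.
split=> [Xj|[Xn1 Xj] l].
  split=> [|l /andP[nl lnk]]; apply: Xj; first by rewrite ltnSn addnS ltnS leq_addr.
  by rewrite (ltnW nl) -addSnnS.
rewrite addnS -addSn => /andP[nl lnk].
have [->//|l_neq] := eqVneq l n.+1.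
by apply: Xj; rewrite lnk andbT ltn_neqAle eq_sym l_neq.
Qed.

Lemma measurable_avoids j n k : measurable (avoids j n k).
Proof.
case: X_markov => mX _; elim: k n => [|k IHk] n.
  by rewrite avoids0; exact: measurableT.
rewrite (_ : avoids j n k.+1 = ~` (X n.+1 @^-1` [set j]) `&` avoids j n.+1 k).
  by apply: measurableI => //; apply: measurableC.
apply/seteqP; split=> w; rewrite avoidsS => -[/eqP Xn Xj]; split=> //; exact/eqP.
Qed.

Lemma measurable_history h n : measurable (history X h n).
Proof.
case: X_markov => mX _.
rewrite (_ : history X h n = \bigcap_(k in [set k | (k <= n)%N]) X k @^-1` [set h k]).
  by apply: bigcap_measurableType => k _.
by apply/seteqP; split=> w.
Qed.

Lemma measure_partition_ord n (B : set Omega) : measurable B ->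
  Pr B = (\sum_(b < m) Pr (B `&` X n @^-1` [set b]))%E.
Proof.
case: X_markov => mX _ mB.
rewrite -(measure_bigsetU_ord Pr xpredT) /=; last 2 first.
- by move=> b; apply: measurableI => //; exact: mX.
- by move=> b c _ _ [w [[_ <-] [_ <-]]].
congr (Pr _); apply/seteqP; split=> w.
  by move=> Bw; rewrite (bigD1 (X n w)) //=; left.
by elim/big_ind: _ => //= [C D BC BD [/BC|/BD]|b _ []].
Qed.

(** Splitting on the value b of X_{n+1} extends the history by b and shortens the window by one, so
    the induction needs arbitrary [h] and [n]. The product form also covers histories of probability
    0. *)
Lemma probability_avoids j k h n :
  Pr (history X h n `&` avoids j n k) = (Pr (history X h n) * (survival P j k (h n))%:E)%E.
Proof.
case: (X_markov) => mX X_step.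
elim: k h n => [|k IHk] h n.
  by rewrite mule1 avoids0 setIT.
rewrite (measure_partition_ord n.+1); last first.
  by apply: measurableI; [exact: measurable_history|exact: measurable_avoids].
rewrite (bigD1 j) //= [X in Pr X](_ : _ = set0) ?measure0 ?add0e; last first.
  by apply/seteqP; split=> // w [[_ /avoidsS[/eqP Xj _]] /= ].
rewrite -sumEFin ge0_sume_distrr; last first.
  by move=> b _; rewrite lee_fin mulr_ge0 ?survival_ge0 //; case: P_stochastic.
apply: eq_bigr => b bj; pose h' l := if l == n.+1 then b else h l.
have h'E l : (l <= n)%N -> h' l = h l.
  by rewrite /h'; case: eqVneq => // ->; rewrite ltnn.
have h'S : h' n.+1 = b by rewrite /h' eqxx.
have -> : history X h n `&` avoids j n k.+1 `&` X n.+1 @^-1` [set b] =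
          history X h' n.+1 `&` avoids j n.+1 k.
  apply/seteqP; split=> w /=.
    move=> [[hw /avoidsS[_ Xj]] Xb]; split=> // l.
    rewrite leq_eqVlt => /predU1P[->|ln]; first by rewrite h'S.
    by rewrite h'E // hw.
  move=> [hw Xj]; have Xb : X n.+1 w = b by rewrite hw.
  split=> //; split; last by apply/avoidsS; rewrite Xb.
  by move=> l ln; rewrite hw ?h'E // leqW.
rewrite IHk X_step h'S h'E // EFinM muleA; congr (Pr _ * _ * _)%E.
by apply/seteqP; split=> w hw l ln; rewrite hw // h'E.
Qed.

Lemma first_passage_series j w :
  first_passage R X j w = (\sum_(0 <= n <oo) (\1_(avoids j 0 n) w)%:E)%E.
Proof.
have ind0 n : (0 <= (\1_(avoids j 0 n) w : R)%:E)%E by rewrite lee_fin.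
(* If j is visited, with first visit at n, the indicator of T_j > k is 1 exactly for k < n, and the
   series sums to n. *)
have [[n0 n0P]|nov] := pselect (exists n, (0 < n)%N && (X n w == j)).
  have [n nP n_min] := @ex_minnP (fun n => (0 < n)%N && (X n w == j)) (ex_intro _ n0 n0P).
  have av k : avoids j 0 k w <-> (k < n)%N.
    split=> [Xj|kn l /andP[l0]].
      rewrite ltnNge; apply/negP => nk.
      case/andP: nP => n_gt0 /eqP Xn.
      by have := Xj n; rewrite n_gt0 add0n nk Xn eqxx => /(_ isT).
    rewrite add0n => lk; apply/negP => Xl.
    by have := n_min l; rewrite l0 Xl => /(_ isT); rewrite leqNgt (leq_ltn_trans lk kn).
  rewrite (nneseries_split 0 n) // add0n.
  rewrite eseries0 ?adde0; last first.
    by move=> k nk _; rewrite indicE memNset // => /av; rewrite ltnNge nk.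
  rewrite big_nat; under eq_bigr => k /andP[_ kn].
    rewrite indicE mem_set; last by apply/av. over.
  rewrite -big_nat sumEFin sumr_const_nat subn0.
  apply/eqP; rewrite eq_le; apply/andP; split.
    by apply: ereal_inf_lbound; exists n => //; case/andP: nP => n_gt0 /eqP.
  apply/ereal_infP => _ [k /= [k_gt0 Xk] <-]; rewrite lee_fin ler_nat.
  by apply: n_min; rewrite k_gt0 Xk eqxx.
(* If j is never visited, the infimum of the empty set is +oo. All indicators are 1, so the partial
   sums exceed every real x. *)
have av k : avoids j 0 k w.
  by move=> l /andP[l0 _]; apply/negP => Xl; apply: nov; exists l; rewrite l0.
rewrite /first_passage (_ : [set _ | _ in _] = set0); last first.
  apply/seteqP; split=> // _ [k /= [k_gt0 Xk] _]; apply: nov; exists k.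
  by rewrite k_gt0 Xk eqxx.
rewrite ereal_inf0; apply/esym/eqyP => x _.
apply: (@le_trans _ _ (\sum_(0 <= n < (Num.truncn x).+1) (\1_(avoids j 0 n) w)%:E)%E).
  under eq_bigr => k _ do rewrite indicE mem_set //.
  by rewrite sumEFin sumr_const_nat subn0 lee_fin ltW // truncnS_gt.
exact: nneseries_lim_ge.
Qed.

Lemma mean_first_passage_series i j : (0 < Pr (X 0%N @^-1` [set i]))%E ->
  mean_first_passage Pr X i j = (\sum_(0 <= n <oo) (survival P j n i)%:E)%E.
Proof.
move=> Xi; case: (X_markov) => mX _.
rewrite /mean_first_passage /cond_expectation.
under eq_integral => w _ do rewrite first_passage_series.
rewrite integral_nneseries //; last first.
  by move=> n; apply/measurable_EFinP/measurable_indic/measurable_avoids.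
(* A history up to time 0 constrains only X_0, so any path starting at i would do; the constant one
   is taken. *)
have X0E : X 0%N @^-1` [set i] = history X (fun=> i) 0.
  by apply/seteqP; split=> [w Xw k|w]; [rewrite leqn0 => /eqP ->|exact].
have step n : (\int[Pr]_(w in X 0%N @^-1` [set i]) (\1_(avoids j 0 n) w)%:E =
    Pr (X 0%N @^-1` [set i]) * (survival P j n i)%:E)%E.
  rewrite integral_indic //; last exact: measurable_avoids.
  by rewrite setIC X0E; exact: probability_avoids.
rewrite (eq_eseriesr (fun n _ => step n)).
rewrite -[Pr _]fineK ?fin_num_measure // nneseriesZl; last first.
  by move=> n _; rewrite lee_fin survival_ge0.
by rewrite muleAC fineK ?fin_num_measure // divee ?mul1e ?fin_num_measure // gt_eqF.
Qed.

End Passage.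

(** * Kemeny's constant as a trace *)

Lemma kemeny_trace (R : realType) (m : nat) (P : 'M[R]_m) (pi beta : 'cV[R]_m)
    (d : measure_display) (Omega : measurableType d) (Pr : probability Omega R)
    (X : nat -> Omega -> 'I_m) (i : 'I_m) :
  stochastic P -> irreducible_chain P -> stationary P pi -> markov_chain Pr P X ->
  (0 < Pr (X 0%N @^-1` [set i]))%E -> beta^T *m ones = 1%:M ->
  kemeny Pr X pi i = (\tr (invmx (1%:M - P + ones *m beta^T)))%:E.
Proof.
move=> P_stoch P_irr pi_stat X_markov X0_i beta1.
have [_ /matrixP/(_ i 0)] := passage_inverse_trace P_stoch P_irr pi_stat beta1.
rewrite !mxE mulr1 => <-; rewrite /kemeny -sumEFin; apply: eq_bigr => j _.
rewrite !mxE mulr1 mulrC EFinM; congr (_ * _)%E.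
(* Convergence of the real partial sums makes the extended real series finite and equal to
   [mean_passage]. *)
rewrite (mean_first_passage_series P_stoch X_markov) // -EFin_lim; last first.
  exact: (survival_series_cvg P_stoch P_irr pi_stat).
by apply: congr_lim; apply/funext => N /=; rewrite sumEFin.
Qed.

Theorem theorem17 (R : realType) (m : nat) (P : 'M[R]_m) (pi : 'cV[R]_m)
    (d : measure_display) (Omega : measurableType d) (Pr : probability Omega R)
    (X : nat -> Omega -> 'I_m)
    (P_stochastic : stochastic P)
    (P_irreducible : irreducible_chain P)
    (pi_stationary : stationary P pi)
    (X_markov : markov_chain Pr P X)
    (i : 'I_m) (X0_i : (0 < Pr (X 0%N @^-1` [set i]))%E) :
  (forall (G : 'M[R]_m) (beta : 'cV[R]_m) (gamma : R),
     ginverse (1%:M - P) G -> ginv_param P pi G ones beta gamma ->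
     kemeny Pr X pi i = (\tr G - gamma)%:E) /\
  [/\ 1%:M - P + ones *m pi^T \in unitmx,
      kemeny Pr X pi i = (\tr (fundamental_mx P pi))%:E &
      kemeny Pr X pi i = (\tr (group_inverse_mx P pi) + 1)%:E].
Proof.
have pi1 : pi^T *m ones = 1%:M by case: pi_stationary.
(* This unit trace accounts for both corrections, - gamma for [G] and + 1 for the group inverse. *)
have trace_pi : \tr (ones *m pi^T) = 1 by rewrite mxtrace_mulC pi1 mxtrace1.
have kemenyE := kemeny_trace P_stochastic P_irreducible pi_stationary X_markov X0_i.
split=> [G beta gamma _ [_ beta1 ->]|].
  by rewrite (kemenyE _ beta1) mxtraceD mxtraceZ trace_pi mulr1 addrK.
split.
- by have [] := passage_inverse_trace P_stochastic P_irreducible pi_stationary pi1.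
- exact: kemenyE.
- by rewrite (kemenyE _ pi1) /group_inverse_mx raddfB /= trace_pi subrK.
Qed.
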